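(* Let $J=(q_i)_{i\ge1}$ be a sequence of non-negative integers with $\gcd(q_i,q_j)=1$ for all $i\neq j$, and let $I=(a_j)_{j\ge1}$ be a sequence with every $a_j\in J$ and each $q_i$ appearing infinitely many times in $I$. Let $\mathfrak{n}(I)=\prod_{j\ge1}a_j$ and let $\mathfrak{m}$ be an infinite generalized integer coprime with $\mathfrak{n}(I)$. Then there exists a simple Riesz group of rank one $(G,G^+)$, isomorphic as an abelian group to $\mathbb{Z}_{\mathfrak{n}(I)\cdot\mathfrak{m}}$, which contains a sequence $(D_i)_{i\ge1}$ of unbounded countably generated intervals, descending in the algebraic ordering of the monoid of countably generated intervals (for each $i$ there is a countably generated interval $Y_i$ with $D_{i+1}+Y_i=D_i$), such that $\left(\prod_{j=1}^i q_j\right)D_i=G^+$ for all $i$ and $tD_i\neq G^+$ for every positive integer $t\le q_i-1$.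
   Context: Partially ordered abelian group $(G,G^+)$; simple: $G\neq0$ and every nonzero $u\in G^+$ is an order-unit (for all $x$ there is $n$ with $-nu\le x\le nu$). Riesz group: $x\le y_1+y_2$ in $G^+$ implies $x=x_1+x_2$, $x_j\in G^+$, $x_j\le y_j$. Rank one: isomorphic to a nonzero subgroup of $\mathbb{Q}$. Generalized integers: maps from primes to $\{0,1,\dots,\infty\}$; $\prod_j a_j$ has at a prime $\ell$ the sum of the exponents of $\ell$ in the $a_j$; infinite means not (never $\infty$ and nonzero at finitely many primes); coprime means at each prime one exponent is $0$; products add exponents. $\mathbb{Z}_{\mathfrak{n}}=\{a/b\in\mathbb{Q}: b\mid\mathfrak{n}\}$. An interval in $G^+$ is a nonempty, upward directed, order-hereditary subset of $G^+$; countably generated if it has a countable cofinal subset; $X+Y=\{z\in G^+: z\le x+y,\ x\in X,\ y\in Y\}$, $tX$ the $t$-fold sum. An interval $D$ is unbounded if for an order-unit $u$ and every state $s$ on $(G,u)$ (homomorphism $s\colon G\to\mathbb{R}$, $s(G^+)\subseteq\mathbb{R}^+$, $s(u)=1$) one has $\sup_{x\in D}s(x)=\infty$.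
   Formalization: The integers q_i are taken to be positive rather than non-negative: if some q_i = 0, then n(I) is not a generalized integer and the product of the q_j times D_i would be a 0-fold sum. *)

(* Defs.v *)
From Stdlib Require Import Reals ClassicalEpsilon.
From HB Require Import structures.
From mathcomp Require Import all_boot all_order all_algebra.
Set Implicit Arguments. Unset Strict Implicit. Unset Printing Implicit Defensive.
Import Order.TTheory GRing.Theory Num.Theory.
Local Open Scope ring_scope.

(* A generalized integer: exponent at each prime, None = infinity.
   Values at non-primes are irrelevant (all definitions quantify over primes). *)
Definition gint := nat -> option nat.

Definition gint_of_nat (n : nat) : gint := fun p => Some (logn p n).

Definition gint_mul (a b : gint) : gint := fun p =>
  match a p, b p with Some x, Some y => Some (x + y)%N | _, _ => None end.

Definition ext_sum (x : nat -> option nat) : option nat :=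
  match excluded_middle_informative
     (exists e : nat, (forall j, x j <> None) /\
        exists k0 : nat, forall k : nat, (k0 <= k)%N -> (\sum_(j < k) odflt 0%N (x j))%N = e) with
  | left H => Some (proj1_sig (constructive_indefinite_description _ H))
  | right _ => None
  end.

Definition gint_prod (a : nat -> gint) : gint := fun p => ext_sum (fun j => a j p).

Definition gint_infinite (g : gint) : Prop :=
  ~ ((forall p, prime p -> g p <> None) /\
     exists N, forall p, prime p -> (N <= p)%N -> g p = Some 0%N).

Definition gint_coprime (g h : gint) : Prop :=
  forall p, prime p -> g p = Some 0%N \/ h p = Some 0%N.

Definition gint_dvd (b : nat) (g : gint) : Prop :=
  forall p, prime p -> match g p with None => true | Some e => (logn p b <= e)%N end.

Definition Zgint (g : gint) (r : rat) : Prop :=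
  exists (a : int) (b : nat), (0 < b)%N /\ gint_dvd b g /\ r = a%:~R / b%:R.

Section POG.
Variables (G : zmodType) (P : G -> Prop).

Definition pcone : Prop :=
  P 0 /\ (forall x y, P x -> P y -> P (x + y)) /\ (forall x, P x -> P (- x) -> x = 0).

Definition gle (x y : G) : Prop := P (y - x).

Definition order_unit (u : G) : Prop :=
  P u /\ forall x, exists n : nat, gle (- (u *+ n)) x /\ gle x (u *+ n).

Definition simple_pog : Prop :=
  (exists x : G, x <> 0) /\ forall u, P u -> u <> 0 -> order_unit u.

Definition riesz : Prop :=
  forall x y1 y2, P x -> P y1 -> P y2 -> gle x (y1 + y2) ->
    exists x1 x2, P x1 /\ P x2 /\ x = x1 + x2 /\ gle x1 y1 /\ gle x2 y2.

Definition rank_one : Prop :=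
  (exists x : G, x <> 0) /\
  exists f : G -> rat, (forall x y, f (x - y) = f x - f y) /\ injective f.

Definition interval (D : G -> Prop) : Prop :=
  (forall x, D x -> P x) /\ (exists x, D x) /\
  (forall x y, D x -> D y -> exists z, D z /\ gle x z /\ gle y z) /\
  (forall x z, D x -> P z -> gle z x -> D z).

Definition countably_generated (D : G -> Prop) : Prop :=
  exists s : nat -> G, (forall n, D (s n)) /\ forall x, D x -> exists n, gle x (s n).

Definition cg_interval (D : G -> Prop) : Prop := interval D /\ countably_generated D.

Definition isum (X Y : G -> Prop) : G -> Prop := fun z =>
  P z /\ exists x y, X x /\ Y y /\ gle z (x + y).

Fixpoint imul_aux (X : G -> Prop) (n : nat) : G -> Prop :=
  match n with 0 => X | n'.+1 => isum (imul_aux X n') X end.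

(* t X = X + ... + X (t summands); 0 X := {0} (never used below) *)
Definition imul (t : nat) (X : G -> Prop) : G -> Prop :=
  match t with 0 => fun z => z = 0 | t'.+1 => imul_aux X t' end.

Definition seteq (X Y : G -> Prop) : Prop := forall z, X z <-> Y z.

Definition state (u : G) (s : G -> R) : Prop :=
  (forall x y, s (x + y) = Rplus (s x) (s y)) /\
  (forall x, P x -> Rle R0 (s x)) /\ s u = R1.

Definition unbounded (D : G -> Prop) : Prop :=
  exists u, order_unit u /\
    forall s, state u s -> forall M : R, exists x, D x /\ Rlt M (s x).

End POG.

(* Main.v *)
(* G is the union of an increasing sequence of groups (1/N)Z with N | n(I) m, and G^+ is
   the union of cones P on them, each cofinite in the nonnegative elements and each the
   trace of the next one.  Cofiniteness makes every nonzero positive element an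
   order-unit.  A Riesz decomposition problem is solved by adjoining an element x1 of
   large order modulo (1/N)Z (m is infinite, so there is room) and making the four
   required elements positive: an integer combination of them that returns to (1/N)Z
   involves so many terms that it was already positive.
   With Q_i = q_0 ... q_i, the interval D_i is generated by an increasing sequence
   (top i) such that t * top i >= 1 never holds for t < Q_i.  Each of infinitely many
   stages for j adjoins f of order exactly Q_j modulo (1/N)Z with Q_j f huge, and adds f
   to top i for all i <= j: no multiple t f with t < Q_i <= Q_j returns to (1/N)Z, so
   nothing is gained below, while Q_i (top i) becomes cofinal. *)
Require Import Defs.
From HB Require Import structures.
From mathcomp Require Import all_boot all_order all_algebra.
From Stdlib Require Import ClassicalEpsilon.
From Stdlib Require Reals Lra.
From mathcomp Require Import zify ring lra.
Set Implicit Arguments. Unset Strict Implicit. Unset Printing Implicit Defensive.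
Import Order.TTheory GRing.Theory Num.Theory.
Local Open Scope ring_scope.

(** * Subgroups of the rationals as abelian groups *)

Record subrat (A : zmodClosed rat) := Subrat {subrat_val : rat; _ : subrat_val \in A}.
HB.instance Definition _ (A : zmodClosed rat) := [isSub for @subrat_val A].
HB.instance Definition _ (A : zmodClosed rat) := [Choice of subrat A by <:].
HB.instance Definition _ (A : zmodClosed rat) := [SubChoice_isSubZmodule of subrat A by <:].

(** Excluded middle turns [A] into the boolean predicate that a subtype requires; [f] is the
    inclusion of that subtype. *)
Lemma zmod_of_subgroup (A : rat -> Prop) :
  A 0 -> (forall x y, A x -> A y -> A (x - y)) ->
  exists (G : zmodType) (f : G -> rat), (forall x y, f (x - y) = f x - f y) /\
    injective f /\ forall r, A r <-> exists x, f x = r.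
Proof.
move=> A0 AB.
pose B : {pred rat} := fun x => if excluded_middle_informative (A x) then true else false.
have BP x : reflect (A x) (x \in B).
  by rewrite unfold_in /B; case: excluded_middle_informative => h; constructor.
have Bz : zmod_closed B.
  by split; [exact/BP|move=> x y /BP Ax /BP Ay; apply/BP/AB].
pose S : zmodClosed rat := HB.pack B (GRing.isZmodClosed.Build rat B Bz).
exists (subrat S), val; split; first by move=> x y; rewrite raddfB.
split; first exact: val_inj.
move=> r; split=> [/BP Br|[x <-]]; last by apply/BP; exact: (valP x).
by exists (@Subrat S r Br).
Qed.

(** * Arithmetic of generalized integers *)

(** Infinitely many nonzero terms keep the partial sums from becoming stationary. Hence a prime
    dividing some [q i] has infinite exponent in n(I), as [q i] recurs in the sequence. *)
Lemma ext_sum_infinite (x : nat -> option nat) :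
  (forall N, exists j, (N <= j)%N /\ x j <> Some 0%N) -> ext_sum x = None.
Proof.
move=> x_inf; rewrite /ext_sum; case: excluded_middle_informative => // [[e [xN [k0 xe]]]].
have [j [le_kj xj]] := x_inf k0.
have := xe j.+1 (leqW le_kj); rewrite big_ord_recr /= (xe j le_kj).
case: (x j) xj (xN j) => // y y0 _ /= E; case: y0; congr Some; lia.
Qed.

Lemma gint_dvd_mul (b c : nat) (g h : gint) :
  (0 < b)%N -> (0 < c)%N -> gint_dvd b g ->
  (forall p, prime p -> (p %| c)%N -> match g p with None => true | Some e => (logn p b + logn p c <= e)%N end) ->
  gint_dvd (b * c) g.
Proof.
move=> b0 c0 bg cg p pp; move: (bg p pp) (cg p pp); rewrite lognM //.
have [pc _ /(_ isT)//|pc + _] := boolP (p %| c)%N.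
by case: (g p) => // e; rewrite (@lognE p c) (negPf pc) !andbF addn0.
Qed.

Lemma gint_dvd_mulr_infinite (b c : nat) (g : gint) :
  (0 < b)%N -> (0 < c)%N -> gint_dvd b g ->
  (forall p, prime p -> (p %| c)%N -> g p = None) -> gint_dvd (b * c) g.
Proof.
by move=> b0 c0 bg cg; apply: gint_dvd_mul => // p pp pc; rewrite cg.
Qed.

Lemma gint_dvd_lcm (b c : nat) (g : gint) :
  (0 < b)%N -> (0 < c)%N -> gint_dvd b g -> gint_dvd c g -> gint_dvd (lcmn b c) g.
Proof.
move=> b0 c0 bg cg p pp; move: (bg p pp) (cg p pp); rewrite logn_lcm //.
by case: (g p) => // e; rewrite geq_max => -> ->.
Qed.

Lemma gint_infinite_mulr (g h : gint) : gint_infinite h -> gint_infinite (gint_mul g h).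
Proof.
move=> hinf [gN [N gz]]; apply: hinf; split.
  by move=> p pp hp; apply: (gN p pp); rewrite /gint_mul hp; case: (g p).
exists N => p pp Np; move: (gz p pp Np); rewrite /gint_mul.
case: (g p) (h p) => [x|] [y|] // [xy]; congr Some; lia.
Qed.

(** [M] is a high power of a prime of infinite exponent or, if there is none, one prime of nonzero
    exponent, so large that it does not divide [N]. *)
Lemma gint_infinite_unbounded_dvd (g : gint) (N B : nat) :
  gint_infinite g -> (0 < N)%N -> gint_dvd N g ->
  exists M, (B <= M)%N /\ gint_dvd (N * M) g.
Proof.
move=> ginf N0 Ng.
have [[p [pp gp]]|gfin] := excluded_middle_informative (exists p, prime p /\ g p = None).
  exists (p ^ B)%N; split; first by rewrite ltnW // ltn_expl // prime_gt1.
  apply: gint_dvd_mulr_infinite => //; first by rewrite expn_gt0 prime_gt0.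
  move=> r rp; rewrite Euclid_dvdX // => /andP[]; rewrite dvdn_prime2 // => /eqP-> _.
  exact: gp.
have [[p [pp [Bp gp]]]|gz] := excluded_middle_informative
    (exists p, prime p /\ (B + N < p)%N /\ g p <> Some 0%N).
  exists p; split; first by lia.
  apply: gint_dvd_mul => // [|r rp]; first exact: prime_gt0.
  rewrite dvdn_prime2 // => /eqP->; case: (g p) gp => // e e0.
  have -> : logn p p = 1%N by rewrite logn_prime // eqxx.
  have -> : logn p N = 0%N.
    rewrite lognE; case: ifP => // /and3P[_ _ /dvdn_leq]; lia.
  by case: e e0.
case: ginf; split=> [p pp gp|]; first by case: gfin; exists p.
exists (B + N).+1 => p pp Np; apply: NNPP => gp; apply: gz; by exists p.
Qed.

(** * Intervals generated by increasing sequences *)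

(** Every interval of the construction has this form with [c] increasing, so sums and multiples are
    computed on generators. *)
Definition down (G : zmodType) (P : G -> Prop) (c : nat -> G) (z : G) : Prop :=
  P z /\ exists n, gle P z (c n).

Definition increasing_in (G : zmodType) (P : G -> Prop) (c : nat -> G) : Prop :=
  forall n, P (c n) /\ P (c n.+1 - c n).

Lemma pcone_mulrn (G : zmodType) (P : G -> Prop) (x : G) n :
  pcone P -> P x -> P (x *+ n).
Proof.
move=> [P0 [PD _]] Px; elim: n => [|n IHn]; first by rewrite mulr0n.
by rewrite mulrS; apply: PD.
Qed.

Lemma gle_trans (G : zmodType) (P : G -> Prop) (x y z : G) :
  pcone P -> gle P x y -> gle P y z -> gle P x z.
Proof.
by move=> [_ [PD _]] xy yz; rewrite /gle -(subrKA y); apply: PD.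
Qed.

Lemma gleD (G : zmodType) (P : G -> Prop) (x y z t : G) :
  pcone P -> gle P x y -> gle P z t -> gle P (x + z) (y + t).
Proof.
by move=> [_ [PD _]] xy yz; rewrite /gle opprD addrACA; apply: PD.
Qed.

Lemma increasing_in_homo (G : zmodType) (P : G -> Prop) (c : nat -> G) m n :
  pcone P -> increasing_in P c -> (m <= n)%N -> gle P (c m) (c n).
Proof.
move=> Pc cP /subnK <-; elim: (n - m)%N => [|k IHk].
  by rewrite /gle subrr; case: Pc.
by apply: (gle_trans Pc IHk); case: (cP (k + m)%N).
Qed.

Lemma increasing_in_mulrn (G : zmodType) (P : G -> Prop) (c : nat -> G) t :
  pcone P -> increasing_in P c -> increasing_in P (fun n => c n *+ t).
Proof.
move=> Pc cP n; have [? ?] := cP n.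
by split; rewrite -?mulrnBl; apply: pcone_mulrn.
Qed.

Lemma down_cg_interval (G : zmodType) (P : G -> Prop) (c : nat -> G) :
  pcone P -> increasing_in P c -> cg_interval P (down P c).
Proof.
move=> Pc cP; have P0 : P 0 by case: Pc.
have downc n : down P c (c n).
  by split; [case: (cP n)|exists n; rewrite /gle subrr].
split; last by exists c; split=> // x [].
split; first by move=> x [].
split; first by exists (c 0%N).
split=> [x y [_ [m xm]] [_ [n yn]]|x z [_ [n xn]] Pz zx]; last first.
  by split=> //; exists n; apply: gle_trans xn.
exists (c (maxn m n)); split=> //.
by split; [apply: gle_trans xm _|apply: gle_trans yn _] => //;
  apply: increasing_in_homo; rewrite // ?leq_maxl ?leq_maxr.
Qed.

Lemma isum_down (G : zmodType) (P : G -> Prop) (c d : nat -> G) :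
  pcone P -> increasing_in P c -> increasing_in P d ->
  seteq (isum P (down P c) (down P d)) (down P (fun n => c n + d n)).
Proof.
move=> Pc cP dP z; have P0 : P 0 by case: Pc.
split=> [[Pz [x [y [[_ [m xm]] [[_ [n yn]] zxy]]]]]|[Pz [n zn]]].
  split=> //; exists (maxn m n); apply: (gle_trans Pc zxy).
  by apply: gleD => //; [apply: gle_trans xm _|apply: gle_trans yn _] => //;
    apply: increasing_in_homo; rewrite // ?leq_maxl ?leq_maxr.
split=> //; exists (c n), (d n); split; last split=> //.
  by split; [case: (cP n)|exists n; rewrite /gle subrr].
by split; [case: (dP n)|exists n; rewrite /gle subrr].
Qed.

Lemma eq_isuml (G : zmodType) (P : G -> Prop) (X X' Y : G -> Prop) :
  seteq X X' -> seteq (isum P X Y) (isum P X' Y).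
Proof.
move=> XX' z; split=> [[Pz [x [y [Xx H]]]]|[Pz [x [y [Xx H]]]]].
all: by split=> //; exists x, y; split=> //; apply/XX'.
Qed.

Lemma eq_down (G : zmodType) (P : G -> Prop) (c d : nat -> G) :
  c =1 d -> seteq (down P c) (down P d).
Proof.
by move=> cd z; split=> -[Pz [n zn]]; split=> //; exists n; rewrite ?cd // -cd.
Qed.

Lemma seteq_trans (G : zmodType) (X Y Z : G -> Prop) :
  seteq X Y -> seteq Y Z -> seteq X Z.
Proof. by move=> XY YZ z; rewrite (XY z). Qed.

Lemma imul_down (G : zmodType) (P : G -> Prop) (c : nat -> G) t :
  pcone P -> increasing_in P c -> (0 < t)%N ->
  seteq (imul P t (down P c)) (down P (fun n => c n *+ t)).
Proof.
move=> Pc cP; case: t => // t _ /=; elim: t => [|t IHt] //=.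
apply: seteq_trans (eq_isuml _ _ IHt) _.
apply: seteq_trans (isum_down Pc (increasing_in_mulrn _ Pc cP) cP) _.
by apply: eq_down => n; rewrite [RHS]mulrSr.
Qed.

(** * States and unboundedness *)

Lemma state_mulrn (G : zmodType) (P : G -> Prop) (u : G) (s : G -> Rdefinitions.R) (x : G) n :
  state P u s -> s (x *+ n) = Rdefinitions.Rmult (Raxioms.INR n) (s x).
Proof.
move=> [sD _]; elim: n => [|n IHn].
  have := sD 0 0; rewrite addr0 mulr0n /=; move: (s 0) (s x) => a b; Lra.lra.
by rewrite mulrSr sD IHn RIneq.S_INR; Lra.lra.
Qed.

(** A state turns [gle P (u *+ k) (x *+ T)] into [k <= T s(x)]; a [k] above [T M] then forces
    [s(x) > M]. *)
Lemma unbounded_of_multiple (G : zmodType) (P : G -> Prop) (u : G) (D : G -> Prop) T :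
  order_unit P u -> (forall k, exists x, D x /\ gle P (u *+ k) (x *+ T)) -> unbounded P D.
Proof.
move=> uu Du; exists u; split=> // s su M.
have [k Mk] := RIneq.INR_unbounded (Rdefinitions.Rmult (Raxioms.INR T) M).
have [x [Dx ux]] := Du k; exists x; split=> //.
have := su => -[sD [sP s1]].
have := sP _ ux; have := sD (x *+ T - u *+ k) (u *+ k); rewrite subrK.
rewrite !(state_mulrn _ _ su) s1 => E E0.
have := RIneq.pos_INR T; move: (s _) (s x) (Raxioms.INR T) (Raxioms.INR k) (RIneq.pos_INR k) Mk E E0 => v w r l l0 Mk E E0 r0.
have : Rdefinitions.Rlt (Rdefinitions.Rmult r M) (Rdefinitions.Rmult r w) by Lra.lra.
apply: RIneq.Rmult_lt_reg_l.
by case: r0 => // r0; move: Mk E; rewrite -r0; Lra.lra.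
Qed.

(** * The groups (1/N)Z, written [lat N], and cofinite cones on them *)

Definition lat (N : nat) (x : rat) : bool := x * N%:R \is a Num.int.

Lemma lat0 N : lat N 0.
Proof. by rewrite /lat mul0r. Qed.

Lemma latD N x y : lat N x -> lat N y -> lat N (x + y).
Proof. by rewrite /lat mulrDl => ? ?; apply: rpredD. Qed.

Lemma latB N x y : lat N x -> lat N y -> lat N (x - y).
Proof. by rewrite /lat mulrBl => ? ?; apply: rpredB. Qed.

Lemma latM N (n : nat) x : lat N x -> lat N (n%:R * x).
Proof. by rewrite /lat -mulrA => ?; rewrite rpredM ?natr_int. Qed.

Lemma lat_nat N n : lat N n%:R.
Proof. by rewrite /lat -natrM natr_int. Qed.

Lemma lat_dvdn N N' x : (N %| N')%N -> lat N x -> lat N' x.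
Proof.
by move=> /dvdnP[k ->]; rewrite /lat mulnC natrM mulrA => ?; rewrite rpredM ?natr_int.
Qed.

Lemma lat_frac N (k : int) : (0 < N)%N -> lat N (k%:~R / N%:R).
Proof. by move=> N0; rewrite /lat divfK ?intr_int // pnatr_eq0 -lt0n. Qed.

Lemma lat_gap N x : (0 < N)%N -> lat N x -> 0 < x -> 1 <= x * N%:R.
Proof.
move=> N0 /intrP[k xk] x0.
have : 0 < x * N%:R by rewrite mulr_gt0 // ltr0n.
by rewrite xk (ltr0z _ k) (ler1z _ k).
Qed.

(** [cone_ge0] makes the cone proper; [cone_large] is the cofiniteness that turns nonzero positive
    elements into order-units. *)
Record cone_on (N : nat) (P : rat -> Prop) : Prop := ConeOn {
  cone_den : (0 < N)%N;
  cone_lat : forall x, P x -> lat N x;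
  cone_ge0 : forall x, P x -> 0 <= x;
  cone0 : P 0;
  coneD : forall x y, P x -> P y -> P (x + y);
  cone_large : exists C : nat, forall x, lat N x -> C%:R <= x -> P x }.

Lemma coneM N P (n : nat) x : cone_on N P -> P x -> P (n%:R * x).
Proof.
move=> Pc Px; elim: n => [|n IHn]; first by rewrite mul0r; apply: cone0 Pc.
by rewrite -natr1 mulrDl mul1r; apply: (coneD Pc).
Qed.

(** * Extensions of cones to larger denominators *)

(** The equivalence settles the positivity of an element once it appears, so negative facts such as
    [valid_small] survive too. *)
Definition extends (N : nat) (P : rat -> Prop) (N' : nat) (P' : rat -> Prop) : Prop :=
  (N %| N')%N /\ forall x, lat N x -> (P' x <-> P x).

Lemma extends_sub N P N' P' x : cone_on N P -> extends N P N' P' -> P x -> P' x.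
Proof. by move=> Pc [_ PP'] Px; apply/PP' => //; apply: (cone_lat Pc). Qed.

Lemma extends_trans N P N' P' N'' P'' :
  extends N P N' P' -> extends N' P' N'' P'' -> extends N P N'' P''.
Proof.
move=> [NN' PP'] [NN'' PP'']; split=> [|x Nx]; first exact: dvdn_trans NN''.
by rewrite PP'' ?PP' //; apply: lat_dvdn Nx.
Qed.

(* Adding all the large elements makes any cone cofinite without changing its
   trace on (1/N)Z, where the large elements are already positive. *)
Lemma extend_by_monoid N P N' (T : rat -> Prop) (B : nat) :
  cone_on N P -> (N %| N')%N -> (0 < N')%N ->
  (forall x, T x -> lat N' x) -> (forall x, T x -> 0 <= x) ->
  (forall x y, T x -> T y -> T (x + y)) -> (forall x, P x -> T x) ->
  (forall x, T x -> lat N x -> P x) ->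
  exists P', cone_on N' P' /\ extends N P N' P' /\ (forall x, T x -> P' x) /\
    forall x, P' x -> x < B%:R -> T x.
Proof.
move=> Pc NN' N'0 Tlat T0 TD PT TP; have [C PC] := cone_large Pc.
(* The summand [C] keeps the trace on (1/N)Z equal to [P]; the summand [B] leaves only [T] below
   [B]. *)
exists (fun x => T x \/ (lat N' x /\ (B + C)%:R <= x)).
split; [split=> //|split; [split=> // x Nx|split]].
- by move=> x [/Tlat|[]].
- by move=> x [/T0//|[_]]; apply: le_trans.
- by left; apply/PT/(cone0 Pc).
- move=> x y [Tx|[Nx Cx]] [Ty|[Ny Cy]]; [by left; apply: TD|right..].
  + by split; [apply: latD => //; apply: Tlat|rewrite -[leLHS]add0r lerD // T0].
  + by split; [apply: latD => //; apply: Tlat|rewrite -[leLHS]addr0 lerD // T0].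
  + by split; [apply: latD|rewrite -[leLHS]add0r lerD // (le_trans _ Cx)].
- by exists (B + C)%N => x Nx Cx; right.
- split=> [[/TP|[_ Cx]]|/PT]; [exact|apply: PC => //|by left].
  by apply: le_trans Cx; rewrite ler_nat leq_addl.
- by move=> x; left.
- move=> x [//|[_ Cx]] xB; have := le_lt_trans Cx xB.
  by rewrite ltr_nat ltnNge leq_addr.
Qed.

Lemma nat_above (x : rat) : exists n : nat, x <= n%:R.
Proof. by exists (Num.trunc x).+1; apply/ltW/truncnS_gt. Qed.

(* r/(NM) has order at least M/2 modulo (1/N)Z since gcd(r, M) divides 2. *)
Lemma lat_order N M r s (j : int) :
  (0 < N)%N -> (0 < s <= 2)%N -> M = (r.*2 + s)%N ->
  lat N (j%:~R * (r%:R / (N * M)%:R)) -> j = 0 \/ (M <= `|j|.*2)%N.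
Proof.
move=> N0 s12 Mrs /intrP[k].
have M0 : (0 < M)%N by lia.
have N0' : N%:R != 0 :> rat by rewrite pnatr_eq0 -lt0n.
have M0' : M%:R != 0 :> rat by rewrite pnatr_eq0 -lt0n.
rewrite natrM => E; have {}E : j * r%:Z = k * M%:Z.
  apply/eqP; rewrite -(eqr_int rat) !rmorphM /= -E !pmulrn; apply/eqP; field.
  exact/andP.
(* Double [j r = k M] and use [2 r = M - s]. A nonzero [j - 2 k] then forces [|j| s >= M] with
   [s <= 2]. *)
have {}E : j * s%:Z = (j - 2 * k) * M%:Z by rewrite Mrs in E *; lia.
have [d0|d0] := eqVneq (j - 2 * k) 0.
  by left; move: E; rewrite d0 mul0r => /eqP; rewrite mulf_eq0 => /orP[/eqP//|]; lia.
right; have : absz (j * s%:Z) = absz ((j - 2 * k) * M%:Z) by rewrite E.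
rewrite !abszM !absz_nat.
have : (0 < absz (j - 2 * k)%R)%N by rewrite absz_gt0.
move: (absz (_ - _)%R) (absz j) => u v u0 uv.
have: (M <= u * M)%N by rewrite leq_pmull.
have: (v * s <= v * 2)%N by rewrite leq_mul2l; case/andP: s12 => _ ->; rewrite orbT.
lia.
Qed.

(** The balance condition cancels [x1]. What remains is [a x + (b - a) y2 + c (y1 + y2 - x)] if
    [a <= b], and [b x + (a - b) y1 + d (y1 + y2 - x)] otherwise. *)
Lemma balanced_combination N P (x y1 y2 x1 : rat) (a b c d : nat) :
  cone_on N P -> P x -> P y1 -> P y2 -> P (y1 + y2 - x) -> (a + d = b + c)%N ->
  P (a%:R * x1 + b%:R * (x - x1) + c%:R * (y1 - x1) + d%:R * (y2 - (x - x1))).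
Proof.
move=> Pc Px Py1 Py2 Py abcd.
have comb k l m z w v : P z -> P w -> P v -> P (k%:R * z + l%:R * w + m%:R * v).
  by move=> Pz Pw Pv; do 2?[apply: (coneD Pc)]; apply: coneM Pc _.
have [ab|/ltnW ba] := leqP a b.
  have := comb a (b - a)%N c x y2 (y1 + y2 - x) Px Py2 Py.
  rewrite natrB //; have -> : c%:R = a%:R + d%:R - b%:R :> rat by rewrite -natrD abcd natrD; ring.
  by congr P; ring.
have := comb b (a - b)%N d x y1 (y1 + y2 - x) Px Py1 Py.
rewrite natrB //; have -> : c%:R = a%:R + d%:R - b%:R :> rat by rewrite -natrD abcd natrD; ring.
by congr P; ring.
Qed.

Definition refines (P : rat -> Prop) (x y1 y2 : rat) : Prop :=
  exists x1, [/\ P x1, P (x - x1), P (y1 - x1) & P (y2 - (x - x1))].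

(* The new element x1 has large order modulo (1/N)Z, so a combination of the four
   new positive elements that lands in (1/N)Z is either balanced, hence a
   combination of x, y1, y2, y1 + y2 - x, or has so many terms that it is large. *)
Lemma extend_refines_interior g N P x y1 y2 lo hi :
  cone_on N P -> gint_dvd N g ->
  (forall B, exists M, (B <= M)%N /\ gint_dvd (N * M) g) ->
  P x -> P y1 -> P y2 -> P (y1 + y2 - x) ->
  lat N lo -> lat N hi -> 0 <= lo -> x - y2 <= lo -> hi <= x -> hi <= y1 -> lo < hi ->
  exists N' P', [/\ gint_dvd N' g, cone_on N' P', extends N P N' P' & refines P' x y1 y2].
Proof.
move=> Pc Ng Minf Px Py1 Py2 Py Nlo Nhi lo0 xlo hix hiy lohi.
have N0 := cone_den Pc; have [C PC] := cone_large Pc.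
(* This bound gives [r >= 2 N C], so at least [M / 2] terms, each at least [r / (N M)], sum to at
   least [r / (2 N) >= C]. *)
have [M [CM NMg]] := Minf (4 * (N * C) + 4)%N.
pose r := (M.-1)./2; pose s := (M - r.*2)%N.
have s12 : (0 < s <= 2)%N by rewrite /s /r; lia.
have Mrs : M = (r.*2 + s)%N by rewrite /s /r; lia.
have rC : (2 * (N * C) <= r)%N by rewrite /r; lia.
have r2M : (r * 2 <= M)%N by lia.
clearbody r s; have M0 : (0 < M)%N by lia.
have NM0 : (0 < N * M)%N by rewrite muln_gt0 N0.
pose e : rat := (N * M)%:R^-1; have [x1 x1E] : exists x1, x1 = lo + r%:R * e by exists (lo + r%:R * e).
have N'0 : N%:R != 0 :> rat by rewrite pnatr_eq0 -lt0n.
have M'0 : M%:R != 0 :> rat by rewrite pnatr_eq0 -lt0n.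
have e0 : 0 < e by rewrite invr_gt0 ltr0n.
have eNM : e * N%:R * M%:R = 1 by rewrite /e natrM; field; apply/andP.
have lohiM : lo + M%:R * e <= hi.
  have /(lat_gap N0) : lat N (hi - lo) by apply: latB.
  rewrite subr_gt0 => /(_ lohi) gap.
  have : 0 <= e * M%:R * ((hi - lo) * N%:R - 1) by rewrite mulr_ge0 ?subr_ge0 // mulr_ge0 // ltW.
  have -> : e * M%:R * ((hi - lo) * N%:R - 1) = (e * N%:R * M%:R) * (hi - lo) - M%:R * e by ring.
  by rewrite eNM; lra.
have e_ge0 := ltW e0; have re0 : 0 <= r%:R * e by rewrite mulr_ge0.
have reM : r%:R * e *+ 2 <= M%:R * e.
  have : r%:R * 2 <= M%:R :> rat by rewrite -natrM ler_nat.
  by move/(ler_wpM2r e_ge0); rewrite mulrAC mulr_natr.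
have ge_x1 : r%:R * e <= x1 by rewrite x1E; lra.
have ge_x2 : r%:R * e <= x - x1 by rewrite x1E; lra.
have ge_x3 : r%:R * e <= y1 - x1 by rewrite x1E; lra.
have ge_x4 : r%:R * e <= y2 - (x - x1) by rewrite x1E; lra.
have N'dv : (N %| N * M)%N by apply: dvdn_mulr.
have lat' y : P y -> lat (N * M) y by move/(cone_lat Pc); apply: lat_dvdn.
have latx1 : lat (N * M) x1.
  rewrite x1E; apply: latD; first exact: lat_dvdn Nlo.
  by apply: latM; rewrite /lat mulVf ?rpred1 // pnatr_eq0 -lt0n.
pose w (a b c d : nat) : rat :=
  a%:R * x1 + b%:R * (x - x1) + c%:R * (y1 - x1) + d%:R * (y2 - (x - x1)).
have w_ge a b c d : (a + b + c + d)%:R * (r%:R * e) <= w a b c d.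
  by rewrite !natrD !mulrDl /w !lerD // ler_wpM2l.
have w_lat a b c d : lat (N * M) (w a b c d).
  have ? := lat' _ Px; have ? := lat' _ Py1; have ? := lat' _ Py2.
  rewrite /w.
  by apply: latD; [apply: latD; [apply: latD|]|]; apply: latM => //; do ?apply: latB.
pose T z := exists p a b c d, P p /\ z = p + w a b c d.
have Tw a b c d : T (w a b c d).
  by exists 0, a, b, c, d; rewrite add0r; split=> //; apply: cone0 Pc.
have TP z : T z -> lat N z -> P z.
  move=> [p [a [b [c [d [Pp zE]]]]]] Nz.
  pose j : int := a%:Z + d%:Z - b%:Z - c%:Z.
  have Nx := cone_lat Pc Px; have Ny1 := cone_lat Pc Py1; have Ny2 := cone_lat Pc Py2.
  have Np := cone_lat Pc Pp.
  have Nj : lat N (j%:~R * (r%:R * e)).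
    have -> : j%:~R * (r%:R * e) = z - p - (b%:R * x + c%:R * y1 + d%:R * (y2 - x))
        - ((a%:R * lo + d%:R * lo) - (b%:R * lo + c%:R * lo)).
      by rewrite zE /w x1E /j !(rmorphB, rmorphD) /= -!pmulrn; ring.
    apply: latB; last by apply: latB; apply: latD; apply: latM.
    apply: latB; first exact: latB.
    by apply: latD; [apply: latD|]; apply: latM => //; apply: latB.
  have [j0|Mj] := lat_order N0 s12 Mrs Nj.
    rewrite zE; apply: (coneD Pc) => //; apply: balanced_combination Pc _ _ _ _ _ => //.
    by move: j0; rewrite /j; clear; lia.
  apply: PC => //; apply: (@le_trans _ _ (w a b c d)); last first.
    by rewrite zE lerDr (cone_ge0 Pc).
  apply: le_trans (w_ge a b c d).
  have abcd : (M <= 2 * (a + b + c + d))%N by move: Mj; rewrite /j; clear; lia.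
  have : M%:R * (r%:R * e) <= 2 * (a + b + c + d)%:R * (r%:R * e).
    by rewrite ler_wpM2r // -natrM ler_nat.
  have : 2 * C%:R <= M%:R * (r%:R * e).
    rewrite -(ler_pM2r (_ : 0 < N%:R)) ?ltr0n //.
    have -> : M%:R * (r%:R * e) * N%:R = r%:R * (e * N%:R * M%:R) by ring.
    by rewrite eNM mulr1 -!natrM ler_nat; move: rC; clear; lia.
  by lra.
have [|||||P' [P'c [PP' [TP' _]]]] :=
    @extend_by_monoid N P (N * M)%N T 0%N Pc N'dv NM0.
- by move=> z [p [a [b [c [d [Pp ->]]]]]]; apply: latD => //; apply: lat'.
- move=> z [p [a [b [c [d [Pp ->]]]]]]; apply: addr_ge0; first exact: (cone_ge0 Pc).
  by apply: le_trans (w_ge a b c d); rewrite mulr_ge0.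
- move=> z z' [p [a [b [c [d [Pp ->]]]]]] [p' [a' [b' [c' [d' [Pp' ->]]]]]].
  exists (p + p'), (a + a')%N, (b + b')%N, (c + c')%N, (d + d')%N.
  by split; [apply: (coneD Pc)|rewrite /w !natrD; ring].
- by move=> p Pp; exists p, 0%N, 0%N, 0%N, 0%N; rewrite /w; split=> //; ring.
- exact: TP.
exists (N * M)%N, P'; split=> //; exists x1; split; apply: TP'.
- by have := Tw 1%N 0%N 0%N 0%N; congr T; rewrite /w; ring.
- by have := Tw 0%N 1%N 0%N 0%N; congr T; rewrite /w; ring.
- by have := Tw 0%N 0%N 1%N 0%N; congr T; rewrite /w; ring.
- by have := Tw 0%N 0%N 0%N 1%N; congr T; rewrite /w; ring.
Qed.

(** If one of [x], [y1], [y2], [y1 + y2 - x] is 0, then 0, [x] or [y1] serves as [x1]. Otherwise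
    max(0, x - y2) < min(x, y1), and there is room for a new [x1] strictly between. *)
Lemma extend_refines g N P x y1 y2 :
  cone_on N P -> gint_dvd N g ->
  (forall B, exists M, (B <= M)%N /\ gint_dvd (N * M) g) ->
  P x -> P y1 -> P y2 -> P (y1 + y2 - x) ->
  exists N' P', [/\ gint_dvd N' g, cone_on N' P', extends N P N' P' & refines P' x y1 y2].
Proof.
move=> Pc Ng Minf Px Py1 Py2 Py.
have P0 := cone0 Pc; have Pge := cone_ge0 Pc; have PN := cone_lat Pc.
have trivial_case : refines P x y1 y2 ->
    exists N' P', [/\ gint_dvd N' g, cone_on N' P', extends N P N' P' & refines P' x y1 y2].
  by exists N, P; split.
have [x0|xN0] := eqVneq x 0; first by apply: trivial_case; exists 0; rewrite x0 !subr0.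
have [y10|y1N0] := eqVneq y1 0.
  by apply: trivial_case; exists 0; rewrite y10 !subr0; split=> //; move: Py; rewrite y10 add0r.
have [y20|y2N0] := eqVneq y2 0.
  by apply: trivial_case; exists x; rewrite y20 !subrr; split=> //; move: Py; rewrite y20 addr0.
have [yx|yNx] := eqVneq (y1 + y2 - x) 0.
  apply: trivial_case; exists y1; have -> : x - y1 = y2 by rewrite -[LHS]addr0 -yx; ring.
  by rewrite !subrr.
have pos z : P z -> z != 0 -> 0 < z by move=> Pz z0; rewrite lt_def z0 Pge.
have {pos xN0 y1N0 y2N0 yNx} [x0 y10 y20 y0] : [/\ 0 < x, 0 < y1, 0 < y2 & 0 < y1 + y2 - x].
  by split; apply: pos.
have Nx := PN _ Px; have Ny1 := PN _ Py1; have Ny2 := PN _ Py2.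
pose lo := if x <= y2 then 0 else x - y2; pose hi := if x <= y1 then x else y1.
apply: (@extend_refines_interior g N P x y1 y2 lo hi) => //; rewrite /lo /hi.
- by case: ifP => _; rewrite ?lat0 ?latB.
- by case: ifP.
- by case: (lerP x y2) => // ?; lra.
- by case: (lerP x y2) => // ?; lra.
- by case: (lerP x y1) => // ?; lra.
- by case: (lerP x y1) => // ?; lra.
- by case: (lerP x y2); case: (lerP x y1) => ? ?; lra.
Qed.

(* The generator f = (Qk+1)/(NQ) has order exactly Q modulo (1/N)Z, and Qf is a
   large element of (1/N)Z, so P is not changed inside (1/N)Z. *)
Lemma extend_fractional N P Q B :
  cone_on N P -> (0 < Q)%N ->
  exists f, lat (N * Q) f /\ (forall x, lat N x -> x <= B%:R -> P (Q%:R * f - x)) /\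
  forall B', exists P', [/\ cone_on (N * Q) P', extends N P (N * Q) P', P' f &
    forall t y, (t < Q)%N -> lat N y -> t%:R * f + y < B'%:R -> P' (t%:R * f + y) -> P y].
Proof.
move=> Pc Q0; have N0 := cone_den Pc; have [C PC] := cone_large Pc.
(* This [k] makes [Q f = (Q k + 1) / N] at least [B + C]; the added 1 makes the numerator coprime to
   [Q]. *)
pose k := (N * (B + C))%N; pose f : rat := (Q * k + 1)%:R / (N * Q)%:R.
have NQ0 : (0 < N * Q)%N by rewrite muln_gt0 N0.
have N'0 : N%:R != 0 :> rat by rewrite pnatr_eq0 -lt0n.
have Q'0 : Q%:R != 0 :> rat by rewrite pnatr_eq0 -lt0n.
have NQ : (N %| N * Q)%N by apply: dvdn_mulr.
have f0 : 0 <= f by rewrite mulr_ge0 ?invr_ge0.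
have fE : f * N%:R * Q%:R = Q%:R * k%:R + 1.
  by rewrite /f !natrD !natrM; field; apply/andP.
have latf : lat (N * Q) f by rewrite /f pmulrn; apply: lat_frac.
have latQf : lat N (Q%:R * f).
  by rewrite /lat -mulrA mulrC fE -natrM natr1 natr_int.
have Qf_ge : (B + C)%:R <= Q%:R * f.
  rewrite -(ler_pM2r (_ : 0 < N%:R)) ?ltr0n //.
  have -> : Q%:R * f * N%:R = f * N%:R * Q%:R by ring.
  rewrite fE -!natrM natr1 ler_nat /k mulnC.
  by rewrite ltnW // ltnS leq_pmull.
clearbody f k.
have lat_fz (l : int) : lat N (l%:~R * f) -> exists c : int, l = c * Q%:Z.
  move=> /intrP[m E].
  have {}E : m%:~R * Q%:R = l%:~R * (Q%:R * k%:R + 1) :> rat by rewrite -fE -E; ring.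
  have {}E : m * Q%:Z = l * (Q%:Z * k%:Z + 1).
    by apply/eqP; rewrite -(eqr_int rat) !(rmorphM, rmorphD) /= -!pmulrn; apply/eqP.
  by exists (m - l * k%:Z); rewrite mulrBl E; ring.
exists f; split=> //; split.
  move=> x Nx xB; apply: PC; first exact: latB.
  by move: Qf_ge; rewrite natrD; lra.
have PQf : P (Q%:R * f).
  by apply: PC => //; apply: le_trans Qf_ge; rewrite ler_nat leq_addl.
move=> B'; pose T z := exists p (l : nat), P p /\ z = p + l%:R * f.
(* Modulo (1/N)Z the two multiples of [f] agree, so [l - t = c Q]. Since [t < Q] and [l >= 0], [c]
   is nonnegative and [y = p + c (Q f)] lies in [P]. *)
have TP t y : (t < Q)%N -> lat N y -> T (t%:R * f + y) -> P y.
  move=> tQ Ny [p [l [Pp E]]].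
  have /lat_fz[c lc] : lat N ((l%:Z - t%:Z)%:~R * f).
    have -> : (l%:Z - t%:Z)%:~R * f = y - p.
      by rewrite rmorphB /= -!pmulrn mulrBl; lra.
    by apply: latB => //; apply: (cone_lat Pc).
  have [n cn] : exists n : nat, c = n%:Z.
    case: c lc => [n _|n]; first by exists n.
    by rewrite NegzE => H; exfalso; nia.
  have lE : l = (n * Q + t)%N by move: lc; rewrite cn; lia.
  have -> : y = p + n%:R * (Q%:R * f).
    by move: E; rewrite lE natrD natrM; lra.
  by apply: (coneD Pc) => //; apply: coneM Pc _.
have [|||||P' [P'c [PP' [TP' P'T]]]] :=
    @extend_by_monoid N P (N * Q)%N T B' Pc NQ NQ0.
- move=> z [p [l [Pp ->]]]; apply: latD; last exact: latM.
  by apply: lat_dvdn NQ _; apply: (cone_lat Pc).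
- by move=> z [p [l [Pp ->]]]; apply: addr_ge0; [exact: (cone_ge0 Pc)|exact: mulr_ge0].
- move=> z z' [p [l [Pp ->]]] [p' [l' [Pp' ->]]]; exists (p + p'), (l + l')%N.
  by split; [apply: (coneD Pc)|rewrite natrD; ring].
- by move=> p Pp; exists p, 0%N; split=> //; ring.
- by move=> y Ty Ny; apply: (TP 0%N); rewrite // mul0r add0r.
exists P'; split=> //.
  by apply: TP'; exists 0, 1%N; split; [apply: cone0 Pc|ring].
by move=> t y tQ Ny yB P'y; apply: (TP t) => //; apply: P'T.
Qed.

(** Only large elements are added. Applied to every [b] dividing [g], this makes the union of the
    groups all of [Zgint g]. *)
Lemma extend_den N P b :
  cone_on N P -> (0 < b)%N ->
  exists P', cone_on (lcmn N b) P' /\ extends N P (lcmn N b) P'.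
Proof.
move=> Pc b0.
have lcm0 : (0 < lcmn N b)%N by rewrite lcmn_gt0 (cone_den Pc).
have lcmN x : P x -> lat (lcmn N b) x.
  by move/(cone_lat Pc); apply: lat_dvdn; apply: dvdn_lcml.
have [//|P' [P'c [PP' _]]] := extend_by_monoid 0 Pc (dvdn_lcml N b) lcm0 lcmN
  (cone_ge0 Pc) (coneD Pc) (fun x => id) _.
by exists P'.
Qed.

(** * Stages of the construction *)

Record stage := Stage { den : nat; cone : rat -> Prop; top : nat -> rat }.

(** [top s i] is the current generator of D_i. [valid_gap] makes these intervals descend, and
    [valid_small] keeps 1 outside [t D_i]. *)
Record valid (g : gint) (Q : nat -> nat) (s : stage) : Prop := Valid {
  valid_cone : cone_on (den s) (cone s);
  valid_dvd : gint_dvd (den s) g;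
  valid_one : cone s 1;
  valid_top : forall i, cone s (top s i);
  valid_gap : forall i, cone s (top s i - top s i.+1);
  valid_small : forall i t, (t < Q i)%N -> ~ cone s (t%:R * top s i - 1) }.

Definition stage_le (s s' : stage) : Prop := extends (den s) (cone s) (den s') (cone s').

(** [n] is both a denominator to absorb, when it divides [g], and a bound on the old elements that
    [Q j] times the increment [f] must dominate. *)
Record next (g : gint) (Q : nat -> nat) (n : nat) (x y1 y2 : rat) (j : nat) (s s' : stage) : Prop := Next {
  next_le : stage_le s s';
  next_den : (0 < n)%N -> gint_dvd n g -> (n %| den s')%N;
  next_refines : cone s x -> cone s y1 -> cone s y2 -> cone s (y1 + y2 - x) ->
    refines (cone s') x y1 y2;
  next_top : exists f, [/\ cone s' f,
    forall i, top s' i = top s i + (if (i <= j)%N then f else 0) &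
    forall z, lat (den s) z -> z <= n%:R -> cone s' ((Q j)%:R * f - z)] }.

(** With the tops kept, [valid_small] concerns only elements of the old group, where the trace is
    unchanged. *)
Lemma valid_extends g Q s N' P' :
  valid g Q s -> cone_on N' P' -> gint_dvd N' g -> extends (den s) (cone s) N' P' ->
  valid g Q (Stage N' P' (top s)).
Proof.
move=> [sc sg s1 st sgap ss] P'c N'g PP'; have sub := extends_sub sc PP'.
split=> //= [|i|i|i t tQ]; [exact: sub|exact: sub|exact: sub|].
rewrite (PP'.2 _ _); first exact: ss.
by apply: latB; [apply/latM/(cone_lat sc)|apply: lat_nat 1%N].
Qed.

Lemma refines_sub (P P' : rat -> Prop) x y1 y2 :
  (forall z, P z -> P' z) -> refines P x y1 y2 -> refines P' x y1 y2.
Proof. by move=> PP' [x1 [? ? ? ?]]; exists x1; split; apply: PP'. Qed.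

Lemma top_le_top0 g Q s i : valid g Q s -> top s i <= top s 0%N.
Proof.
move=> sv; elim: i => // i IHi; apply: le_trans IHi.
by rewrite -subr_ge0; apply: (cone_ge0 (valid_cone sv)); apply: valid_gap sv _.
Qed.

Lemma step_den g Q s b : valid g Q s ->
  exists s', [/\ valid g Q s', stage_le s s', top s' = top s &
    (0 < b)%N -> gint_dvd b g -> (b %| den s')%N].
Proof.
move=> sv; have sc := valid_cone sv.
have [[b0 bg]|nb] := excluded_middle_informative ((0 < b)%N /\ gint_dvd b g); last first.
  by exists s; split=> // b0 bg; case: nb.
have [P' [P'c PP']] := extend_den sc b0.
exists (Stage (lcmn (den s) b) P' (top s)); split=> //=; last by rewrite dvdn_lcmr.
apply: valid_extends => //; apply: gint_dvd_lcm => //; first exact: cone_den sc.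
exact: valid_dvd sv.
Qed.

Lemma step_refines g Q s x y1 y2 : gint_infinite g -> valid g Q s ->
  exists s', [/\ valid g Q s', stage_le s s', top s' = top s &
    cone s x -> cone s y1 -> cone s y2 -> cone s (y1 + y2 - x) -> refines (cone s') x y1 y2].
Proof.
move=> ginf sv; have sc := valid_cone sv; have sg := valid_dvd sv.
have [[Px Py1 Py2 Py]|nP] := excluded_middle_informative
    [/\ cone s x, cone s y1, cone s y2 & cone s (y1 + y2 - x)]; last first.
  by exists s; split=> // Px Py1 Py2 Py; case: nP.
have Minf B := gint_infinite_unbounded_dvd B ginf (cone_den sc) sg.
have [N' [P' [N'g P'c PP' ref]]] := extend_refines sc sg Minf Px Py1 Py2 Py.
by exists (Stage N' P' (top s)); split=> //; apply: valid_extends.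
Qed.

Lemma step_top g Q s j B : valid g Q s -> (forall i, (0 < Q i)%N) ->
  {homo Q : i k / (i <= k)%N} -> (forall p, prime p -> (p %| Q j)%N -> g p = None) ->
  exists s' f, [/\ valid g Q s', stage_le s s', cone s' f,
    forall i, top s' i = top s i + (if (i <= j)%N then f else 0) &
    forall z, lat (den s) z -> z <= B%:R -> cone s' ((Q j)%:R * f - z)].
Proof.
move=> sv Q0 Qle Qg; have [sc sg s1 st sgap ss] := sv; have N0 := cone_den sc.
have [f [latf [fB ext]]] := extend_fractional B sc (Q0 j).
(* [B'] bounds [t (f + top s i)] for all [t < Q j], since [top s 0] is the largest top; below it the
   last clause on [f] applies. *)
have [B' hB'] := nat_above ((Q j)%:R * f + (Q j)%:R * top s 0%N).
have [P' [P'c PP' P'f P'small]] := ext B'.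
have sub := extends_sub sc PP'.
pose top' i := top s i + (if (i <= j)%N then f else 0).
exists (Stage (den s * Q j) P' top'), f.
split=> //= [|z Nz zB]; last by apply: sub; apply: fB.
have lat_small t i : lat (den s) (t%:R * top s i - 1).
  by apply: latB; [apply/latM/(cone_lat sc)|apply: lat_nat 1%N].
split=> //=.
- exact: gint_dvd_mulr_infinite.
- exact: sub.
- move=> i; rewrite /top'; case: ifP => _; last by rewrite addr0; apply: sub.
  by apply: (coneD P'c) => //; apply: sub.
- move=> i; rewrite /top'.
  have -> : top s i + (if (i <= j)%N then f else 0) - (top s i.+1 + (if (i < j)%N then f else 0))
      = (top s i - top s i.+1) + (if i == j then f else 0).
    by case: (ltngtP i j) => _; ring.
  by apply: (coneD P'c); [apply: sub|case: eqP => // _; apply: cone0 P'c].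
move=> i t tQ; rewrite /top'; case: leqP => ij; last first.
  by rewrite addr0 (PP'.2 _ (lat_small t i)); apply: ss.
(* Monotonicity of [Q] keeps [t] below [Q j], the order of [f]. *)
have tQj := leq_trans tQ (Qle _ _ ij).
rewrite (_ : _ - 1 = t%:R * f + (t%:R * top s i - 1)); last by ring.
move/(P'small _ _ tQj (lat_small t i)) => H; apply: (ss i t tQ); apply: H.
have f0 := cone_ge0 P'c P'f; have top0 := cone_ge0 sc (st i).
have tQ' : t%:R <= (Q j)%:R :> rat by rewrite ler_nat ltnW.
have := ler_pM (ler0n _ t) f0 tQ' (lexx f).
have := ler_pM (ler0n _ t) top0 tQ' (top_le_top0 i sv).
lra.
Qed.

Lemma stage_step g Q s n x y1 y2 j : gint_infinite g -> valid g Q s ->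
  (forall i, (0 < Q i)%N) -> {homo Q : i k / (i <= k)%N} ->
  (forall p, prime p -> (p %| Q j)%N -> g p = None) ->
  exists s', valid g Q s' /\ next g Q n x y1 y2 j s s'.
Proof.
move=> ginf sv Q0 Qle Qg.
have [s1 [s1v ss1 top1 den1]] := step_den n sv.
have [s2 [s2v s12 top2 ref2]] := step_refines x y1 y2 ginf s1v.
have [s3 [f [s3v s23 s3f top3 f3]]] := step_top n s2v Q0 Qle Qg.
exists s3; split=> //; split.
- exact: extends_trans ss1 (extends_trans s12 s23).
- move=> n0 ng; apply: dvdn_trans (den1 n0 ng) _.
  by apply: dvdn_trans s12.1 s23.1.
- move=> Px Py1 Py2 Py; apply: (refines_sub (P := cone s2)).
    by move=> z; apply: extends_sub s23; apply: valid_cone s2v.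
  by apply: ref2; apply: (extends_sub (valid_cone sv) ss1).
exists f; split=> // [i|z Nz zn]; first by rewrite top3 top2 top1.
apply: f3 => //; apply: lat_dvdn Nz; apply: dvdn_trans ss1.1 s12.1.
Qed.

(* logn 2 takes every value infinitely often. *)
Definition task (n : nat) : rat * rat * rat * nat :=
  odflt (0, 0, 0, 0%N) (unpickle (logn 2 n.+1)).

Lemma task_infinitely_often t n0 : exists n, (n0 <= n)%N /\ task n = t.
Proof.
have log0 : logn 2 n0.*2.+1 = 0%N by rewrite lognE dvdn2 /= odd_double.
have taskE e : task (2 ^ e * n0.*2.+1).-1 = odflt (0, 0, 0, 0%N) (unpickle e).
  rewrite /task prednK ?muln_gt0 ?expn_gt0 // lognM ?expn_gt0 // pfactorK //.
  by rewrite log0 addn0.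
(* The odd factor makes the index large without changing the 2-adic valuation; the predecessor
   undoes the shift in [task]. *)
exists (2 ^ pickle t * n0.*2.+1).-1; split; last by rewrite taskE pickleK.
move: (pickle t) => e; have : (1 * n0.*2.+1 <= 2 ^ e * n0.*2.+1)%N.
  by rewrite leq_mul2r expn_gt0 orbT.
lia.
Qed.

Lemma stages_exist g Q : gint_infinite g ->
  (forall i, (0 < Q i)%N) -> {homo Q : i k / (i <= k)%N} ->
  (forall j p, prime p -> (p %| Q j)%N -> g p = None) ->
  exists s : nat -> stage, forall n, valid g Q (s n) /\
    let: (x, y1, y2, j) := task n in next g Q n x y1 y2 j (s n) (s n.+1).
Proof.
move=> ginf Q0 Qle Qg.
pose s0 := Stage 1 (fun x => lat 1 x /\ 0 <= x) (fun=> 0).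
have s0v : valid g Q s0.
  split=> //=; first split=> //.
  - by move=> x [].
  - by move=> x [].
  - by move=> x y [? ?] [? ?]; split; [apply: latD|apply: addr_ge0].
  - by exists 0%N.
  - by move=> p pp; rewrite logn1; case: (g p).
  - by move=> i t _ [_]; rewrite mulr0 sub0r oppr_ge0 ler10.
have step (n : nat) (s : {s | valid g Q s}) : exists s' : {s | valid g Q s},
    let: (x, y1, y2, j) := task n in next g Q n x y1 y2 j (sval s) (sval s').
  case: s => s sv; case: (task n) => [[[x y1] y2] j].
  have [s' [s'v ss']] := stage_step n x y1 y2 ginf sv Q0 Qle (Qg j).
  by exists (exist _ s' s'v).
pose S := nat_rect (fun=> {s | valid g Q s}) (exist _ s0 s0v)
  (fun n s => sval (constructive_indefinite_description _ (step n s))).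
exists (fun n => sval (S n)) => n; split; first exact: svalP (S n).
exact: svalP (constructive_indefinite_description _ (step n (S n))).
Qed.

(** * The union of the stages *)

Lemma ZgintP g x : Zgint g x <-> exists N, [/\ (0 < N)%N, gint_dvd N g & lat N x].
Proof.
split=> [[a [b [b0 [bg ->]]]]|[N [N0 Ng /intrP[a xa]]]].
  by exists b; split=> //; apply: lat_frac.
exists a, N; split=> //; split=> //; rewrite -xa mulfK // pnatr_eq0 -lt0n //.
Qed.

Lemma ZgintB g x y : Zgint g x -> Zgint g y -> Zgint g (x - y).
Proof.
move=> /ZgintP[N [N0 Ng Nx]] /ZgintP[N' [N'0 N'g N'y]]; apply/ZgintP.
exists (lcmn N N'); split; [by rewrite lcmn_gt0 N0|exact: gint_dvd_lcm|].
by apply: latB; [apply: lat_dvdn Nx; apply: dvdn_lcml|apply: lat_dvdn N'y; apply: dvdn_lcmr].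
Qed.

Lemma Zgint_nat g n : Zgint g n%:R.
Proof.
apply/ZgintP; exists 1%N; split=> //; last exact: lat_nat.
by move=> p pp; rewrite logn1; case: (g p).
Qed.

(** [d i] generates D_i. The second half of [wild_gap] makes the differences [d i n - d i.+1 n]
    increase in [n], so that they generate the complement Y_i. *)
Record wild_cone (A : rat -> Prop) (Q : nat -> nat) (P : rat -> Prop)
    (d : nat -> nat -> rat) : Prop := WildCone {
  wild_sub : forall x, P x -> A x;
  wild0 : P 0;
  wild1 : P 1;
  wildD : forall x y, P x -> P y -> P (x + y);
  wild_ge0 : forall x, P x -> 0 <= x;
  wild_unit : forall u x, P u -> u != 0 -> A x ->
    exists n : nat, P (n%:R * u - x) /\ P (n%:R * u + x);
  wild_riesz : forall x y1 y2, P x -> P y1 -> P y2 -> P (y1 + y2 - x) -> refines P x y1 y2;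
  wild_gen : forall i n, P (d i n) /\ P (d i n.+1 - d i n);
  wild_gap : forall i n, P (d i n - d i.+1 n) /\
    P ((d i n.+1 - d i.+1 n.+1) - (d i n - d i.+1 n));
  wild_cofinal : forall i x, A x -> exists n, P ((Q i)%:R * d i n - x);
  wild_small : forall i t n, (t < Q i)%N -> ~ P (t%:R * d i n - 1) }.

Lemma wild_cone_exists g Q : gint_infinite g ->
  (forall i, (0 < Q i)%N) -> {homo Q : i k / (i <= k)%N} ->
  (forall j p, prime p -> (p %| Q j)%N -> g p = None) ->
  exists P d, wild_cone (Zgint g) Q P d.
Proof.
move=> ginf Q0 Qle Qg; have [s sE] := stages_exist ginf Q0 Qle Qg.
have sv n := (sE n).1; have sc n := valid_cone (sv n).
have le1 n : stage_le (s n) (s n.+1).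
  by have := (sE n).2; case: (task n) => [[[x y1] y2] j] [].
have le_s m n : (m <= n)%N -> stage_le (s m) (s n).
  move/subnK <-; elim: (n - m)%N => // k IHk.
  exact: extends_trans IHk (le1 _).
have cone_le m n x : (m <= n)%N -> cone (s m) x -> cone (s n) x.
  by move=> mn; apply: (extends_sub (sc m) (le_s _ _ mn)).
have lat_le m n x : (m <= n)%N -> lat (den (s m)) x -> lat (den (s n)) x.
  by move=> mn; apply: lat_dvdn (le_s _ _ mn).1.
pose P x := exists n, cone (s n) x.
(* Traces are coherent, so positivity in the union is decided at any stage whose group contains
   [x]. *)
have latP n x : lat (den (s n)) x -> P x -> cone (s n) x.
  move=> Nx [m Px]; apply/((le_s n (maxn m n) (leq_maxr _ _)).2 x Nx).
  by apply: cone_le Px; apply: leq_maxl.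
(* Step number [b] absorbs the denominator [b]. *)
have ZP x : Zgint g x -> exists n0, forall n, (n0 <= n)%N -> lat (den (s n)) x.
  move/ZgintP=> [b [b0 bg bx]]; exists b.+1 => n bn; apply: lat_le bn _.
  apply: lat_dvdn bx; have := (sE b).2; case: (task b) => [[[y y1] y2] j].
  by move=> H; apply: (next_den H).
have PA x : P x -> Zgint g x.
  move=> [n Px]; apply/ZgintP; exists (den (s n)); split.
  - exact: cone_den (sc n).
  - exact: valid_dvd (sv n).
  - exact: cone_lat Px.
have PD x y : P x -> P y -> P (x + y).
  move=> [m Px] [n Py]; exists (maxn m n); apply: (coneD (sc _)).
    by apply: cone_le Px; apply: leq_maxl.
  by apply: cone_le Py; apply: leq_maxr.
exists P, (fun i n => top (s n) i); split=> //.
- by exists 0%N; apply: cone0 (sc 0%N).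
- by exists 0%N; apply: valid_one (sv 0%N).
- by move=> x [n Px]; apply: (cone_ge0 (sc n)).
- move=> u x Pu u0 Ax; have [nu Nu] := ZP _ (PA _ Pu); have [nx Nx] := ZP _ Ax.
  pose n := maxn nu nx; have {}Nu := Nu n (leq_maxl _ _); have {}Nx := Nx n (leq_maxr _ _).
  have {u0} u_gt0 : 0 < u by rewrite lt_def u0 (cone_ge0 (sc n)) //; apply: latP.
  have [C PC] := cone_large (sc n).
  have [k kC] := nat_above ((C%:R + `|x|) / u).
  have {kC} : C%:R + `|x| <= k%:R * u by rewrite -ler_pdivrMr.
  have := ler_norm x; have := ler_norm (- x); rewrite normrN => x1 x2 kC.
  exists k; split; exists n; apply: PC; do ?[lra|exact: latM].
    by apply: latB => //; apply: latM.
  by apply: latD => //; apply: latM.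
- move=> x y1 y2 Px Py1 Py2 Py.
  have [n1 N1] := ZP _ (PA _ Px); have [n2 N2] := ZP _ (PA _ Py1).
  have [n3 N3] := ZP _ (PA _ Py2); have [n4 N4] := ZP _ (PA _ Py).
  (* The problem recurs after all its data have entered the groups; the last component 0 is an
     arbitrary [j]. *)
  have [n [nn tn]] := task_infinitely_often (x, y1, y2, 0%N) (n1 + n2 + n3 + n4).
  have := (sE n).2; rewrite tn => /next_refines H.
  apply: (refines_sub (P := cone (s n.+1))); first by move=> z; exists n.+1.
  by apply: H; apply: latP => //; [apply: N1|apply: N2|apply: N3|apply: N4]; lia.
- move=> i n; split; first by exists n; apply: valid_top (sv n) _.
  exists n.+1; have := (sE n).2; case: (task n) => [[[x y1] y2] j] [_ _ _ [f [Pf -> _]]].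
  by rewrite addrC addKr; case: ifP => // _; apply: cone0 (sc _).
- move=> i n; split; first by exists n; apply: valid_gap (sv n) _.
  exists n.+1; have := (sE n).2; case: (task n) => [[[x y1] y2] j] [_ _ _ [f [Pf E _]]].
  rewrite !E (_ : _ - _ = if i == j then f else 0); last by case: (ltngtP i j) => _; ring.
  by case: eqP => // _; apply: cone0 (sc _).
- move=> i x Ax; have [n0 Nx] := ZP _ Ax; have [B xB] := nat_above x.
  (* A late step for [i] has [n >= B >= x], so its increment [f] makes [Q i] times [f] dominate
     [x]. *)
  have [n [nn tn]] := task_infinitely_often (0, 0, 0, i) (n0 + B).
  have := (sE n).2; rewrite tn => -[_ _ _ [f [Pf E fB]]].
  exists n.+1, n.+1; rewrite E leqnn mulrDr -addrA.
  apply: (coneD (sc _)); first apply: (coneM _ (sc _)).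
    by apply: cone_le (leqnSn n) _; apply: valid_top (sv n) _.
  apply: fB; first by apply: Nx; lia.
  by apply: le_trans xB _; rewrite ler_nat; lia.
move=> i t n tQ PH; apply: (valid_small (sv n) tQ (latP n _ _ PH)).
by apply: latB; [apply/latM/(cone_lat (sc n))/(valid_top (sv n))|apply: lat_nat 1%N].
Qed.

(** * Transfer to an abstract group *)

Theorem theorem3p7
  (q : nat -> nat) (a : nat -> nat) (m : gint)
  (q_pos : forall i, (0 < q i)%N)
  (q_coprime : forall i j, i <> j -> gcdn (q i) (q j) = 1%N)
  (a_in_J : forall j, exists i, a j = q i)
  (a_inf : forall i N, exists j, (N <= j)%N /\ a j = q i)
  (m_inf : gint_infinite m)
  (m_coprime : gint_coprime (gint_prod (fun j => gint_of_nat (a j))) m) :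
  exists (G : zmodType) (P : G -> Prop),
    pcone P /\ simple_pog P /\ riesz P /\ rank_one G /\
    (exists f : G -> rat, (forall x y, f (x - y) = f x - f y) /\ injective f /\
       (forall r, Zgint (gint_mul (gint_prod (fun j => gint_of_nat (a j))) m) r <->
                  exists x, f x = r)) /\
    exists D : nat -> (G -> Prop),
      (forall i, cg_interval P (D i) /\ unbounded P (D i)) /\
      (forall i, exists Y, cg_interval P Y /\ seteq (isum P (D i.+1) Y) (D i)) /\
      (forall i, seteq (imul P (\prod_(j < i.+1) q j)%N (D i)) P) /\
      (forall i t, (0 < t)%N -> (t <= q i - 1)%N -> ~ seteq (imul P t (D i)) P).
Proof.
set g := gint_mul _ _; pose Q i := (\prod_(j < i.+1) q j)%N.
have ginf : gint_infinite g by apply: gint_infinite_mulr.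
have Q0 i : (0 < Q i)%N by rewrite prodn_gt0.
have QS i : Q i.+1 = (Q i * q i.+1)%N by rewrite /Q big_ord_recr.
have Qle : {homo Q : i k / (i <= k)%N}.
  by apply: (@homo_leq _ _ leq leqnn leq_trans) => i; rewrite QS leq_pmulr.
have le_qQ i : (q i <= Q i)%N by rewrite /Q big_ord_recr /= leq_pmull // prodn_gt0.
(* The infinite exponents leave room for adjoining the denominator [Q j] again and again. *)
have Qg j p : prime p -> (p %| Q j)%N -> g p = None.
  move=> pp pQ; have [i pq] : exists i, (p %| q i)%N.
    move: pQ; rewrite Euclid_dvd_prod // big_has => /hasP[i _ pi]; by exists (i : nat).
  rewrite /g /gint_mul /gint_prod ext_sum_infinite // => N.
  have [k [Nk ak]] := a_inf i N; exists k; split=> //; rewrite /gint_of_nat ak => -[].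
  by apply/eqP; rewrite -lt0n logn_gt0 mem_primes pp q_pos.
have [P0 [d Pd]] := wild_cone_exists ginf Q0 Qle Qg.
have [G [f [fB [finj fE]]]] := zmod_of_subgroup (Zgint_nat g 0) (@ZgintB g).
have f0 : f 0 = 0 by rewrite -[0 in LHS](subrr 0) fB subrr.
have fN x : f (- x) = - f x by rewrite -[- x]sub0r fB f0 sub0r.
have fD x y : f (x + y) = f x + f y by rewrite -[y in LHS]opprK fB fN opprK.
have fMn x n : f (x *+ n) = n%:R * f x.
  by elim: n => [|n IHn]; rewrite ?f0 ?mul0r // mulrSr fD IHn -natr1 mulrDl mul1r.
pose P x := P0 (f x).
have Pc : pcone P.
  split; first by rewrite /P f0; apply: wild0 Pd.
  split=> [x y Px Py|x Px PNx]; first by rewrite /P fD; apply: (wildD Pd).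
  apply: finj; rewrite f0; apply/eqP; rewrite eq_le (wild_ge0 Pd Px) andbT.
  by rewrite -oppr_ge0 -fN (wild_ge0 Pd PNx).
have [e fe] : exists e, f e = 1 by apply/fE; exact: Zgint_nat 1%N.
have e0 : e <> 0 by move=> e0; move: fe; rewrite e0 f0.
have units u : P u -> u <> 0 -> order_unit P u.
  move=> Pu u0; split=> // x; have fx : Zgint g (f x) by apply/fE; exists x.
  have fu : f u != 0 by apply/eqP => fu; apply: u0; apply: finj; rewrite fu f0.
  have [n [Pn1 Pn2]] := wild_unit Pd Pu fu fx.
  by exists n; split; rewrite /gle /P ?fB ?opprK ?fD ?fN ?fMn ?opprK // addrC.
have Pe : P e by rewrite /P fe; apply: wild1 Pd.
have [dG dGE] : exists dG : nat -> nat -> G, forall i n, f (dG i n) = d i n.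
  have lift i n : exists x, f x = d i n by apply/fE/(wild_sub Pd)/(wild_gen Pd i n).1.
  exists (fun i n => sval (constructive_indefinite_description _ (lift i n))) => i n.
  exact: svalP (constructive_indefinite_description _ (lift i n)).
have dG_inc i : increasing_in P (dG i).
  by move=> n; rewrite /P fB !dGE; apply: wild_gen Pd i n.
have gap_inc i : increasing_in P (fun n => dG i n - dG i.+1 n).
  by move=> n; rewrite /P !fB !dGE; apply: wild_gap Pd i n.
have cofinal i x : exists n, gle P x (dG i n *+ Q i).
  have [n Pn] := wild_cofinal Pd i ((fE (f x)).2 (ex_intro _ x erefl)).
  by exists n; rewrite /gle /P fB fMn dGE.
exists G, P; split=> //; split; first by split; [exists e|exact: units].
split.
  move=> x y1 y2 Px Py1 Py2; rewrite /gle /P fB fD => Py.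
  have [r [Pr1 Pr2 Pr3 Pr4]] := wild_riesz Pd Px Py1 Py2 Py.
  have [x1 x1r] := (fE r).1 (wild_sub Pd Pr1).
  by exists x1, (x - x1); rewrite /gle /P !fB !x1r; do !split=> //; rewrite addrC subrK.
split; first by split; [exists e|exists f].
split; first by exists f.
exists (fun i => down P (dG i)); split=> [i|].
  split; first exact: down_cg_interval.
  apply: (unbounded_of_multiple (u := e) (T := Q i)); first exact: units.
  move=> k; have [n kn] := cofinal i (e *+ k); exists (dG i n); split=> //.
  by split; [exact: (dG_inc i n).1|exists n; rewrite /gle subrr /P f0; apply: wild0 Pd].
split=> [i|].
  (* Y_i is generated by the gaps: added termwise to the generators of D_{i+1}, they restore those
     of D_i. *)
  exists (down P (fun n => dG i n - dG i.+1 n)); split; first exact: down_cg_interval.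
  apply: seteq_trans (isum_down Pc (dG_inc i.+1) (gap_inc i)) _.
  by apply: eq_down => n; rewrite addrC subrK.
split=> [i|i t t0 tq].
  apply: seteq_trans (imul_down Pc (dG_inc i) (Q0 i)) _ => z.
  by split=> [[]//|Pz]; split=> //; apply: cofinal.
(* The preimage [e] of 1 is positive but outside [t D_i], because [t < q i <= Q i]. *)
move=> /(_ e) [_ /(_ Pe)] /(imul_down Pc (dG_inc i) t0)[_ [n]].
rewrite /gle /P fB fMn fe dGE; apply: (wild_small Pd).
by have := le_qQ i; have := q_pos i; lia.
Qed.
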